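(* The set $\mathrm{Nuc}=\{X\in\mathrm{SF}\mid X\text{ is nuclear}\}$ is Borel in $\mathrm{SF}$.
   Context: $C(\mathbb{R})$ is the Fréchet space of continuous real-valued functions on $\mathbb{R}$ with the topology of uniform convergence on compact sets. $\mathrm{SF}=\{X\subseteq C(\mathbb{R})\mid X\text{ is a closed vector subspace}\}$ with the Effros Borel structure, i.e., the $\sigma$-algebra generated by the sets $\{X\in\mathrm{SF}\mid X\cap U\neq\emptyset\}$, $U\subseteq C(\mathbb{R})$ open; it is a standard Borel space. A Fréchet space $X$ is nuclear if all bounded (continuous linear) operators from $X$ to any Banach space are nuclear operators. Equivalently (Grothendieck), with $(\|\cdot\|_n)_n$ a sequence of pseudonorms generating the topology of $X$, $X$ is nuclear if and only if every unconditionally convergent series $\sum_j x_j$ in $X$ is absolutely convergent, i.e., $\sum_j\|x_j\|_n<\infty$ for all $n$. *)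

(* Defs.v *)
From HB Require Import structures.
From mathcomp Require Import all_boot all_order all_algebra.
From mathcomp Require Import all_classical all_reals all_analysis.

Set Implicit Arguments.
Unset Strict Implicit.
Unset Printing Implicit Defensive.

Import Order.TTheory GRing.Theory Num.Theory.
Import numFieldNormedType.Exports.

Local Open Scope classical_set_scope.
Local Open Scope ring_scope.

Definition CR (R : realType) : Type := continuousType R R.

Definition CR_fun (R : realType) (f : CR R) : R -> R := (f : continuousType R R).

(* The compact-open topology; [CR_cvgP] below identifies its convergence with
   uniform convergence on compact sets. *)
HB.instance Definition _ (R : realType) := Choice.copy (CR R) (continuousType R R).
HB.instance Definition _ (R : realType) := Topological.copy (CR R)
  (initial_topology (CR_fun (R := R) : CR R -> {compact-open, R -> R})).

Section CR_lmodule.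
Variable R : realType.
Implicit Types f g h : CR R.

Lemma CR_continuous f : continuous (CR_fun f).
Proof. exact: (@cts_fun _ _ (f : continuousType R R)). Qed.

Lemma CR_ext f g : CR_fun f =1 CR_fun g -> f = g.
Proof. by move=> fg; apply/continuousEP. Qed.

Lemma CR_add_subproof f g : continuous (fun x => CR_fun f x + CR_fun g x).
Proof. by move=> x; apply: cvgD; exact: CR_continuous. Qed.

Lemma CR_opp_subproof f : continuous (fun x => - CR_fun f x).
Proof. by move=> x; apply: cvgN; exact: CR_continuous. Qed.

Lemma CR_scale_subproof (a : R) f : continuous (fun x => a * CR_fun f x).
Proof. by move=> x; apply: cvgM; [exact: cvg_cst | exact: CR_continuous]. Qed.

Definition CR_zero : CR R := (cst 0 : R -> R) : continuousType R R.
Definition CR_add f g : CR R := mkcts (@CR_add_subproof f g) : continuousType R R.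
Definition CR_opp f : CR R := mkcts (@CR_opp_subproof f) : continuousType R R.
Definition CR_scale (a : R) f : CR R :=
  mkcts (@CR_scale_subproof a f) : continuousType R R.

Lemma CR_addA : associative CR_add.
Proof. by move=> f g h; apply: CR_ext => x; exact: addrA. Qed.

Lemma CR_addC : commutative CR_add.
Proof. by move=> f g; apply: CR_ext => x; exact: addrC. Qed.

Lemma CR_add0 : left_id CR_zero CR_add.
Proof. by move=> f; apply: CR_ext => x; exact: add0r. Qed.

Lemma CR_addN : left_inverse CR_zero CR_opp CR_add.
Proof. by move=> f; apply: CR_ext => x; exact: addNr. Qed.

HB.instance Definition _ :=
  GRing.isZmodule.Build (CR R) CR_addA CR_addC CR_add0 CR_addN.

Lemma CR_scaleA a b f : CR_scale a (CR_scale b f) = CR_scale (a * b) f.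
Proof. by apply: CR_ext => x; exact: mulrA. Qed.

Lemma CR_scale1 : left_id 1 CR_scale.
Proof. by move=> f; apply: CR_ext => x; exact: mul1r. Qed.

Lemma CR_scaleDr : right_distributive CR_scale +%R.
Proof. by move=> a f g; apply: CR_ext => x; exact: mulrDr. Qed.

Lemma CR_scaleDl f : {morph CR_scale^~ f : a b / a + b}.
Proof. by move=> a b; apply: CR_ext => x; exact: mulrDl. Qed.

HB.instance Definition _ := GRing.Zmodule_isLmodule.Build R (CR R)
  CR_scaleA CR_scale1 CR_scaleDr CR_scaleDl.

End CR_lmodule.

Lemma CR_cvgP (R : realType) (F : set_system (CR R)) (f : CR R) : Filter F ->
  F --> f <->
  forall K : set R, compact K -> {uniform K, @CR_fun R @ F --> CR_fun f}.
Proof.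
move=> FF; have FF' : Filter (@CR_fun R @ F) by exact: fmap_filter.
have -> : F --> f <-> {compact-open, @CR_fun R @ F --> CR_fun f}.
  split=> [Ff|Ff A [B [[C oC <-] Cf] BA]].
    have cF : continuous (@CR_fun R : CR R -> {compact-open, R -> R}).
      exact: initial_continuous.
    exact: (cvg_comp _ _ Ff (cF f)).
  by apply: filterS BA _; apply: Ff; exact: open_nbhs_nbhs.
rewrite (compact_open_fam_compactP (@CR_continuous _ f)).
exact: fam_cvgP.
Qed.

Record SF (R : realType) := MkSF {
  SF_set :> set (CR R);
  SF_closed : closed SF_set;
  SF_submod : submod_closed [in SF_set]
}.

Section SF_space.
Variables (R : realType) (X : SF R).

Definition SF_pred : {pred CR R} := [in SF_set X].

HB.instance Definition _ := GRing.isSubmodClosed.Build R (CR R) SF_pred (SF_submod X).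

(* The closed subspace X as a space in its own right, with the topology induced
   by C(R). *)
Definition SF_space : Type := set_type (SF_set X).

HB.instance Definition _ := Topological.copy SF_space (set_type (SF_set X)).
HB.instance Definition _ : isSub (CR R) SF_pred SF_space := SubType.on (set_type (SF_set X)).
HB.instance Definition _ := [SubChoice_isSubLmodule of SF_space by <:].

End SF_space.

(* T is nuclear when T x = \sum_n lambda_n phi_n(x) y_n with lambda in l^1,
   (phi_n) an equicontinuous sequence in the dual of E and (y_n) bounded in Y;
   for a normed E, equicontinuity means that (phi_n) is norm bounded. *)
Definition nuclear_operator (R : realType) (E : preTopologicalLmodType R)
    (Y : normedModType R) (T : E -> Y) : Prop :=
  exists (lambda : R^nat) (phi : nat -> {scalar E}) (y : Y^nat),
    [/\ cvgn [normed series lambda],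
        equicontinuous [set: nat] (fun n => phi n : E -> R),
        bounded_set (range y) &
        forall x, series (fun n => (lambda n * phi n x) *: y n) @ \oo --> T x].

(* On a Frechet space, a linear operator into a Banach space is bounded iff it
   is continuous. *)
Definition nuclear_space (R : realType) (E : preTopologicalLmodType R) : Prop :=
  forall (Y : completeNormedModType R) (T : {linear E -> Y}),
    continuous T -> nuclear_operator T.

Definition effros_sets (R : realType) : set (set (SF R)) :=
  [set [set X : SF R | X `&` U !=set0] | U in [set U : set (CR R) | open U]].

Definition Nuc (R : realType) : set (SF R) :=
  [set X : SF R | nuclear_space (SF_space X)].

Section SF_pointed.
Variable R : realType.

Lemma SF_full_submod : submod_closed [in [set: CR R]].
Proof. by split=> [|a f g _ _]; rewrite inE. Qed.

Definition SF_full : SF R := MkSF closedT SF_full_submod.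

HB.instance Definition _ := gen_eqMixin (SF R).
HB.instance Definition _ := gen_choiceMixin (SF R).
HB.instance Definition _ := isPointed.Build (SF R) SF_full.
End SF_pointed.

HB.instance Definition _ (R : realType) :=
  Measurable.copy (SF R) (g_sigma_algebraType (@effros_sets R)).

(* Main.v *)
Require Import Defs.
From HB Require Import structures.
From mathcomp Require Import all_boot all_order all_algebra all_fingroup.
From mathcomp Require Import all_classical all_reals all_analysis.
From mathcomp Require Import ring lra zify.

(** Nuclearity of a closed subspace X of C(R) is equivalent to a condition on
    determinants, [det_decay], which is visibly Borel: for every n there are m and
    C such that for all k, all x_1, ..., x_k in X that are interior to the unit
    ball of the sup norm on [-m, m], and all rational points t_1, ..., t_k of
    [-n, n],

        |det (x_i (t_j))| <= (C / k^2)^k.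

    The condition is Borel because its failure for given n, m, C, k and t is
    witnessed by finitely many elements of X lying in open sets that can be taken
    from a countable family ([measurable_det_gt]): no dense sequence of X has to
    be selected.

    A nuclear space satisfies it ([nuclear_det_decay]).  A sequence of
    equicontinuous functionals is a continuous operator into the Banach space of
    bounded sequences.  Nuclearity of that operator expresses the sequence through
    a summable diagonal and another equicontinuous sequence, and this can be
    repeated.  Starting from the evaluations at the points t_j, the matrix
    x_i (t_j) becomes a product of bounded matrices and summable diagonals.  By
    the Cauchy-Binet formula each diagonal divides the minors of size k by k!,
    whereas by Hadamard's inequality each bounded matrix costs only k^(k/2), up
    to geometric factors.  Five diagonals and six bounded matrices give a bound of
    order (k^k)^3 / (k!)^5, that is k^(-2k) up to a geometric factor.

    Conversely ([det_decay_nuclear]), interpolation at points where the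
    determinant is nearly maximal turns the decay of minors into approximation by
    operators of finite rank: if the minors of size N are at most g^N, then for
    some rank below N the error is at most 2g ([pivoting]).  Writing a continuous
    operator T on X as a telescoping sum over dyadic ranks, the j-th difference
    has rank at most 2^j and size of order 4^-j.  The same interpolation lemma
    with g = 0 decomposes an operator of rank at most r into r terms of rank one,
    each bounded by a multiple of its size, so that the nuclear norms add up to a
    multiple of the sum of the 2^-j. *)

Set Implicit Arguments.
Unset Strict Implicit.
Unset Printing Implicit Defensive.

Import Order.TTheory GRing.Theory Num.Theory.
Import numFieldNormedType.Exports.

Local Open Scope classical_set_scope.
Local Open Scope ring_scope.

(** * Determinants: Schur complements, minors of products, Hadamard's bound *)

Lemma det_block_schur (F : fieldType) (m n : nat) (A : 'M[F]_m) (B : 'M[F]_(m, n))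
    (C : 'M[F]_(n, m)) (D : 'M[F]_n) : D \in unitmx ->
  \det (block_mx A B C D) = \det D * \det (A - B *m invmx D *m C).
Proof.
move=> uD.
have -> : block_mx A B C D = block_mx 1%:M (B *m invmx D) 0 1%:M *m
    block_mx (A - B *m invmx D *m C) 0 C D.
  rewrite mulmx_block !mul1mx !mul0mx !add0r subrK.
  by rewrite mulmxKV.
by rewrite det_mulmx det_ublock det_lblock !det1 !mul1r mulrC.
Qed.

(** An unordered Cauchy-Binet formula: the sum runs over all maps [f] instead of
    over increasing ones.  Each [k]-element set of indices is then counted [k`!]
    times and the maps that are not injective contribute [0], which accounts for
    the factor on the left.  Expanding the product by multilinearity in the rows
    gives a sum over [f] that is not symmetric in [A] and [B]; precomposing [f]
    with a permutation and averaging over all of them symmetrizes it. *)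
Lemma det_mul_minors (K : comNzRingType) (k N : nat) (A : 'M[K]_(k, N))
    (B : 'M[K]_(N, k)) :
  \det (A *m B) *+ k`! = \sum_(f : {ffun 'I_k -> 'I_N})
    \det (colsub f A) * \det (rowsub f B).
Proof.
have detE : \det (A *m B) = \sum_(f : {ffun 'I_k -> 'I_N})
    (\prod_i A i (f i)) * \det (rowsub f B).
  rewrite /determinant.
  under eq_bigr => s _.
    under eq_bigr => i _ do rewrite mxE.
    rewrite bigA_distr_bigA big_distrr /=.
  over.
  rewrite exchange_big /=; apply: eq_bigr => f _.
  rewrite big_distrr /=; apply: eq_bigr => s _.
  rewrite mulrCA -big_split /=; congr (_ * _).
  by apply: eq_bigr => i _; rewrite mxE.
have detP (s : 'S_k) : \det (A *m B) = \sum_(f : {ffun 'I_k -> 'I_N})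
    ((-1) ^+ s * \prod_i A i (f (s i))) * \det (rowsub f B).
  rewrite detE.
  rewrite (reindex_onto (fun f : {ffun 'I_k -> 'I_N} => [ffun i => f (s i)])
    (fun f : {ffun 'I_k -> 'I_N} => [ffun i => f (s^-1%g i)])) /=; last first.
    by move=> f _; apply/ffunP => i; rewrite !ffunE permK.
  apply: eq_big => f.
    by apply/eqP/ffunP => i; rewrite !ffunE permKV.
  move=> _; rewrite -mulrA mulrCA; congr (_ * _).
    by apply: eq_bigr => i _; rewrite ffunE.
  have -> : rowsub [ffun i => f (s i)] B = row_perm s (rowsub f B).
    by apply/matrixP => i j; rewrite !mxE ffunE.
  by rewrite row_permE det_mulmx det_perm.
rewrite -{1}(card_Sn k) -sumr_const.
under eq_bigr => s _ do rewrite (detP s).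
rewrite exchange_big /=; apply: eq_bigr => f _.
rewrite -mulr_suml; congr (_ * _); rewrite {1}/determinant.
apply: eq_big => [s|s _]; first by rewrite inE.
by congr (_ * _); apply: eq_bigr => i _; rewrite mxE.
Qed.

(** The source of all decay: a product through a summable diagonal gains a factor
    [1 / k`!] on its minors of size [k].  The sum over [f] of the products of the
    [`|l (f i)|] is the [k]-th power of the sum of the [`|l n|], and
    [det_mul_minors] divides it by [k`!]. *)
Lemma ler_det_mul_diag (K : realDomainType) (k N : nat) (A : 'M[K]_(k, N))
    (B : 'M[K]_(N, k)) (l : 'I_N -> K) (L a b : K) :
  0 <= a -> 0 <= b -> \sum_n `|l n| <= L ->
  (forall f : 'I_k -> 'I_N, `|\det (colsub f A)| <= a) ->
  (forall f : 'I_k -> 'I_N, `|\det (rowsub f B)| <= b) ->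
  `|\det (\matrix_(i, j) \sum_n l n * A i n * B n j)| *+ k`! <= L ^+ k * a * b.
Proof.
move=> a0 b0 lL Aa Bb.
have -> : \matrix_(i, j) (\sum_n l n * A i n * B n j) =
   A *m (diag_mx (\row_n l n) *m B).
  apply/matrixP => i j; rewrite !mxE; apply: eq_bigr => n _.
  by rewrite mul_diag_mx !mxE mulrCA mulrA.
rewrite -normrMn det_mul_minors.
apply: le_trans (ler_norm_sum _ _ _) _.
have dE (f : {ffun 'I_k -> 'I_N}) : rowsub f (diag_mx (\row_n l n) *m B) =
    diag_mx (\row_i l (f i)) *m rowsub f B.
  by apply/matrixP => i j; rewrite !mul_diag_mx !mxE.
apply: (@le_trans _ _ (\sum_(f : {ffun 'I_k -> 'I_N}) (\prod_i `|l (f i)|) * a * b)).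
  apply: ler_sum => f _; rewrite dE det_mulmx det_diag.
  rewrite !normrM mulrCA normr_prod mulrA.
  under eq_bigr => i _ do rewrite mxE.
  apply: ler_pM; rewrite ?mulr_ge0 ?prodr_ge0 //.
  by apply: ler_wpM2l => //; exact: prodr_ge0.
rewrite -!mulr_suml -!mulrA; apply: ler_wpM2r.
  exact: mulr_ge0.
rewrite -(bigA_distr_bigA (fun (_ : 'I_k) n => `|l n|)) /=.
rewrite prodr_const card_ord; apply: lerXn2r; rewrite ?nnegrE//.
  exact: sumr_ge0.
by apply: le_trans lL; exact: sumr_ge0.
Qed.

Definition posdef (K : realFieldType) n (M : 'M[K]_n) :=
  M^T = M /\ forall x : 'rV[K]_n, x != 0 -> 0 < (x *m M *m x^T) 0 0.

(** The Schur complement with respect to all rows and columns but the first peels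
    off one diagonal entry: it is positive, and it is that entry minus a
    nonnegative number, because the inverse of a positive definite matrix is
    again nonnegative as a quadratic form. *)
Lemma posdef_det (K : realFieldType) n (M : 'M[K]_n) : posdef M ->
  0 < \det M <= \prod_i M i i.
Proof.
elim: n => [|n IH] in M *; first by rewrite det_mx00 big_ord0 ltr01 lexx.
rewrite -[n.+1]/(1 + n)%N in M *.
rewrite -[M]submxK; set a := ulsubmx M; set v := ursubmx M; set w := dlsubmx M.
set D := drsubmx M => -[sM pM].
have [vw sD] : v^T = w /\ D^T = D.
  by move: sM; rewrite tr_block_mx => /eq_block_mx[_ _ vw sD]; split.
have pD : posdef D.
  split=> // y y0; have := pM (row_mx 0 y).
  rewrite mul_row_block tr_row_mx mul_row_col !mul0mx !add0r trmx0 mulmx0 add0r.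
  apply; apply: contraNneq y0 => /(congr1 rsubmx).
  by rewrite row_mxKr => ->; rewrite linear0.
have /andP[D0 DP] := IH _ pD.
have uD : D \in unitmx by rewrite unitmxE unitfE gt_eqF.
set y := v *m invmx D.
have yD : y *m D = v by rewrite mulmxKV.
have yDy : y *m D *m y^T = v *m invmx D *m w.
  by rewrite yD trmx_mul trmx_inv sD -vw mulmxA.
have y_ge0 : 0 <= (v *m invmx D *m w) 0 0.
  rewrite -yDy; have [->|/(proj2 pD)/ltW//] := eqVneq y 0.
  by rewrite !mul0mx mxE.
have s_gt0 : 0 < (a - v *m invmx D *m w) 0 0.
  (* evaluate the quadratic form where it is minimal for a given first entry *)
  have := pM (row_mx 1 (- y)).
  rewrite mul_row_block tr_row_mx mul_row_col !mul1mx !mulNmx yD subrr mul0mx addr0.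
  rewrite trmx1 mulmx1; apply.
  apply/eqP => /(congr1 lsubmx); rewrite row_mxKl => /matrixP/(_ 0 0).
  by rewrite !mxE eqxx => /eqP; rewrite oner_eq0.
rewrite det_block_schur// det_mx11 mulr_gt0//=.
rewrite big_ord_recl mulrC; apply: ler_pM; [exact: ltW|exact: ltW| |].
  have -> : ord0 = lshift n 0 :> 'I_(1 + n) by exact: val_inj.
  by rewrite block_mxEul mxE [X in _ + X]mxE gerDl oppr_le0.
apply: le_trans DP _; rewrite le_eqVlt; apply/orP; left; apply/eqP.
by apply: eq_bigr => i _; rewrite -rshift1 block_mxEdr.
Qed.

(** The Gram matrix [A *m A^T] is positive definite as soon as [A] is invertible,
    and its diagonal entries are the squared norms of the rows of [A]. *)
Lemma hadamard (K : realFieldType) n (A : 'M[K]_n) :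
  (forall i j, `|A i j| <= 1) -> (\det A) ^+ 2 <= (n ^ n)%:R.
Proof.
move=> A1; have [->|dA] := eqVneq (\det A) 0; first by rewrite expr0n.
have uA : A \in unitmx by rewrite unitmxE unitfE.
have sq (x : 'rV[K]_n) : (x *m x^T) 0 0 = \sum_i x 0 i ^+ 2.
  by rewrite mxE; apply: eq_bigr => i _; rewrite mxE expr2.
have /posdef_det/andP[_] : posdef (A *m A^T).
  split; first by rewrite trmx_mul trmxK.
  move=> x x0; rewrite mulmxA -mulmxA -trmx_mul sq.
  rewrite lt_neqAle sumr_ge0 ?andbT => [|i _]; last exact: sqr_ge0.
  apply: contraNneq x0 => /esym/psumr_eq0P x0; apply/eqP.
  rewrite -[x](mulmxK uA) (_ : x *m A = 0) ?mul0mx//.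
  apply/rowP => i; rewrite [RHS]mxE; apply/eqP; rewrite -sqrf_eq0; apply/eqP.
  by rewrite x0// => j _; exact: sqr_ge0.
rewrite det_mulmx det_tr -expr2 => /le_trans; apply.
have -> : (n ^ n)%:R = \prod_(i < n) n%:R :> K.
  by rewrite prodr_const card_ord natrX.
apply: ler_prod => i _; rewrite mxE; apply/andP; split.
  by apply: sumr_ge0 => j _; rewrite mxE -expr2 sqr_ge0.
apply: (@le_trans _ _ (\sum_(j < n) 1)); last by rewrite sumr_const card_ord.
by apply: ler_sum => j _; rewrite mxE -expr2 -real_normK ?num_real// exprn_ile1.
Qed.

Lemma hadamard_scaled (K : rcfType) n (A : 'M[K]_n) (C : K) : 0 < C ->
  (forall i j, `|A i j| <= C) -> `|\det A| <= C ^+ n * Num.sqrt (n ^ n)%:R.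
Proof.
move=> C0 AC.
have -> : A = C *: (\matrix_(i, j) (C^-1 * A i j)).
  by apply/matrixP => i j; rewrite !mxE mulVKf ?gt_eqF.
rewrite detZ normrM normrX gtr0_norm// ler_pM2l ?exprn_gt0//.
rewrite -ler_sqr ?nnegrE ?sqrtr_ge0// sqr_sqrtr// real_normK ?num_real//.
apply: hadamard => i j; rewrite mxE normrM gtr0_norm ?invr_gt0//.
by rewrite ler_pdivrMl// mulr1.
Qed.

Lemma cramer_col (F : fieldType) n (M : 'M[F]_n) (c : 'cV[F]_n) j : M \in unitmx ->
  (invmx M *m c) j 0 =
    \det (\matrix_(i, l) if l == j then c i 0 else M i l) / \det M.
Proof.
move=> uM; set M' := \matrix_(i, l) _.
rewrite (expand_det_col _ j) mulr_suml mxE; apply: eq_bigr => i _.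
have -> : cofactor M' i j = cofactor M i j.
  rewrite /cofactor; congr (_ * \det _); apply/matrixP => a b; rewrite !mxE.
  by rewrite eq_sym (negbTE (neq_lift _ _)).
rewrite /invmx uM !mxE eqxx; ring.
Qed.

Lemma det_mulmx_thin (F : fieldType) (r k : nat) (A : 'M[F]_(k, r)) (B : 'M[F]_(r, k)) :
  (r < k)%N -> \det (A *m B) = 0.
Proof.
move=> rk; apply/eqP/negPn; rewrite -unitfE -unitmxE -row_free_unit /row_free.
apply/negP => /eqP rAB; have := leq_trans (mxrankM_maxr A B) (rank_leq_row B).
by rewrite rAB leqNgt rk.
Qed.

Lemma det_cvg (R : realType) (S : Type) (F : set_system S) (FF : Filter F) k
    (M : S -> 'M[R]_k) (A : 'M[R]_k) :
  (forall i j, (fun s => M s i j) @ F --> A i j) -> (fun s => \det (M s)) @ F --> \det A.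
Proof.
move=> MA; rewrite /determinant.
apply: cvg_big => [|s _]; first exact: add_continuous.
apply: cvgM; first exact: cvg_cst.
apply: cvg_big => [z|i _]; last exact: MA.
by apply: cvgM; [exact: cvg_fst|exact: cvg_snd].
Qed.

(** * Interpolation at points of nearly maximal determinant

    [V] is a space whose elements are sampled by the functionals [ev], and [B]
    plays the role of its unit ball. *)

Section pivoting.
Variables (R : realType) (V : lmodType R) (T : Type) (ev : T -> {scalar V}).
Variable (B : set V).
Hypothesis B1 : forall x t, B x -> `|ev t x| <= 1.

Definition evmx k (x : 'I_k -> V) (t : 'I_k -> T) : 'M[R]_k :=
  \matrix_(i, j) ev (t j) (x i).

Let minors k : set R := [set d | exists (x : 'I_k -> V) (t : 'I_k -> T),
  (forall i, B (x i)) /\ d = `|\det (evmx x t)|].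

Let minors_ub k : has_ubound (minors k).
Proof.
exists (1 ^+ k * Num.sqrt (k ^ k)%:R) => _ [x [t [Bx ->]]].
by apply: hadamard_scaled => // i j; rewrite mxE B1.
Qed.

(** Choose a minor of size [k] that is at least half of the supremum, and let [L]
    be the cardinal functions of the interpolation at its sampling points.  By
    Cramer's rule a value of [L j] is a quotient of two minors of size [k], hence
    at most [2]; by the Schur complement formula the interpolation error is a
    quotient of a minor of size [k.+1] by one of size [k]. *)
Lemma interpolation (g : R) k : 0 <= g ->
  0 < sup (minors k) -> sup (minors k.+1) <= g * sup (minors k) ->
  exists (t : 'I_k -> T) (L : 'I_k -> V),
    (forall j s, `|ev s (L j)| <= 2) /\
    (forall x s, B x -> `|ev s x - \sum_j ev (t j) x * ev s (L j)| <= 2 * g).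
Proof.
move=> g0 D0 Dg.
have m0 : minors k !=set0.
  apply/set0P/eqP => m0; by move: D0; rewrite m0 sup0 ltxx.
have [_ [x [t [Bx ->]]]] := sup_adherent (divr_gt0 D0 (ltr0n _ 2))
  (conj m0 (minors_ub k)).
rewrite (_ : _ - _ = sup (minors k) / 2); last by field.
set M := evmx x t => dM.
have d0 : 0 < `|\det M| by apply: lt_trans dM; rewrite divr_gt0.
have uM : M \in unitmx by rewrite unitmxE unitfE -normr_gt0.
have dM2 : sup (minors k) / `|\det M| <= 2.
  by rewrite ler_pdivrMr// mulrC -ler_pdivrMr// ltW.
exists t, (fun j => \sum_i invmx M j i *: x i); split=> [j s|y s By].
  have -> : ev s (\sum_i invmx M j i *: x i) = (invmx M *m \col_i ev s (x i)) j 0.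
    by rewrite linear_sum mxE; apply: eq_bigr => i _; rewrite linearZ mxE.
  rewrite cramer_col// normrM normfV; apply: le_trans dM2.
  rewrite ler_pM2r ?invr_gt0//; apply: ub_le_sup => //.
  exists x, (fun l => if l == j then s else t l); split=> //.
  by congr (`|\det _|); apply/matrixP => i l; rewrite !mxE; case: eqP => // ->.
set r := ev s y - _.
pose x' (i : 'I_(1 + k)) := if fintype.split i is inr i' then x i' else y.
pose t' (j : 'I_(1 + k)) := if fintype.split j is inr j' then t j' else s.
have rE : \det M * r = \det (evmx x' t').
  set c : 'cV_k := \col_i ev s (x i); set u : 'rV_k := \row_j ev (t j) y.
  have -> : evmx x' t' = block_mx (ev s y)%:M u c M.
    apply/matrixP => i j; rewrite !mxE /x' /t'.
    case: (fintype.split i) => i'; rewrite !mxE; case: (fintype.split j) => j';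
      rewrite ?mxE//.
    by rewrite !ord1 eqxx mulr1n.
  rewrite det_block_schur// det_mx11 -mulmxA mxE [X in _ + X]mxE.
  rewrite [_%:M _ _]mxE eqxx mulr1n [(u *m _) _ _]mxE; congr (_ * (_ - _)).
  apply: eq_bigr => j _; rewrite !mxE; congr (_ * _).
  by rewrite linear_sum; apply: eq_bigr => i _; rewrite linearZ !mxE.
have rM : `|r| * `|\det M| <= sup (minors k.+1).
  rewrite -normrM mulrC rE; apply: ub_le_sup => //.
  by exists x', t'; split=> // i; rewrite /x'; case: (@fintype.split 1 k i).
rewrite -(ler_pM2r d0); apply: le_trans rM _; apply: le_trans Dg _.
rewrite (mulrC 2) -mulrA; apply: ler_wpM2l => //.
by rewrite -ler_pdivrMr.
Qed.

(** The suprema of the minors of sizes [0, ..., N] start at [1] and end below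
    [g ^+ N], so some ratio of consecutive ones is at most [g]; [interpolation]
    applies at that size.  With [g = 0] this is an Auerbach-type lemma: if all
    minors of size [N] vanish, then the samples of every element are
    combinations, with coefficients among those samples, of fewer than [N]
    elements of size at most [2]. *)
Lemma pivoting (g : R) N : (0 < N)%N -> 0 <= g ->
  (forall (x : 'I_N -> V) (t : 'I_N -> T), (forall i, B (x i)) ->
    `|\det (evmx x t)| <= g ^+ N) ->
  exists k (t : 'I_k -> T) (L : 'I_k -> V), [/\ (k < N)%N,
    (forall j s, `|ev s (L j)| <= 2) &
    (forall x s, B x -> `|ev s x - \sum_j ev (t j) x * ev s (L j)| <= 2 * g)].
Proof.
move=> N0 g0 dN; apply: contrapT => nex.
have step k : (k < N)%N -> 0 < sup (minors k) ->
    g * sup (minors k) < sup (minors k.+1).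
  move=> kN D0; rewrite ltNge; apply/negP => Dg; apply: nex.
  by have [t [L [L2 tL]]] := interpolation g0 D0 Dg; exists k, t, L; split.
have D0 : sup (minors 0) = 1.
  rewrite (_ : minors 0 = [set 1]) ?sup1//; apply/seteqP; split=> d /=.
    by case=> x [t [_ ->]]; rewrite det_mx00 normr1.
  move=> ->; exists (fun i : 'I_0 => False_rect _ (notF (ltn_ord i))).
  exists (fun i : 'I_0 => False_rect _ (notF (ltn_ord i))).
  by split=> [[]//|]; rewrite det_mx00 normr1.
have pos k : (k <= N)%N -> g ^+ k <= sup (minors k) /\ 0 < sup (minors k).
  elim: k => [_|k IH kN]; first by rewrite D0.
  have [le0 gt0] := IH (ltnW kN); have lt1 := step _ kN gt0; split.
    by rewrite exprS; apply: le_trans (ltW lt1); exact: ler_wpM2l.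
  by apply: le_lt_trans lt1; rewrite mulr_ge0// ltW.
case: N N0 dN step pos {nex} => // N _ dN step pos.
have [le0 gt0] := pos N (leqnSn _).
have := step N (ltnSn _) gt0; rewrite ltNge => /negP; apply.
apply: (@le_trans _ _ (g ^+ N.+1)); last by rewrite exprS ler_wpM2l.
have [->|/set0P nS] := eqVneq (minors N.+1) set0; first by rewrite sup0 exprn_ge0.
by apply: ge_sup => // _ [x [t [Bx ->]]]; exact: dN.
Qed.

End pivoting.

(** * The Banach space of bounded sequences

    It is the target of all operators to which nuclearity is applied: an
    equicontinuous sequence of functionals is one continuous operator into it. *)

Section linf.
Variable R : realType.

Definition linf_pred : {pred nat -> R^o} :=
  fun f => `[< exists M : R, forall n, `|f n| <= M >].

Lemma linf_submod : submod_closed linf_pred.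
Proof.
split=> [|a f g /asboolP[M fM] /asboolP[N gN]].
  by apply/asboolP; exists 0 => n; rewrite normr0.
apply/asboolP; exists (`|a| * M + N) => n; apply: le_trans (ler_normD _ _) _.
by rewrite lerD// normrM ler_wpM2l.
Qed.

HB.instance Definition _ :=
  GRing.isSubmodClosed.Build R (nat -> R^o) linf_pred linf_submod.

Record linf := Linf { linf_val :> nat -> R^o; linfP : linf_pred linf_val }.

HB.instance Definition _ := [isSub for linf_val].
HB.instance Definition _ := [Choice of linf by <:].
HB.instance Definition _ := [SubChoice_isSubLmodule of linf by <:].

Definition linf_norm (f : linf) : R := sup (range (fun n => `|f n|)).

Lemma linf_le (f : linf) n : `|f n| <= linf_norm f.
Proof.
apply: ub_le_sup; last by exists n.
have /asboolP[M fM] := linfP f.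
by exists M => _ [m _ <-]; exact: fM.
Qed.

Lemma linf_norm_le (f : linf) M : (forall n, `|f n| <= M) -> linf_norm f <= M.
Proof.
move=> fM; apply: ge_sup => [|_ [n _ <-]]; last exact: fM.
by exists `|f 0%N|, 0%N.
Qed.

Lemma linf_normD f g : linf_norm (f + g) <= linf_norm f + linf_norm g.
Proof.
apply: linf_norm_le => n; apply: le_trans (ler_normD _ _) _.
by rewrite lerD// linf_le.
Qed.

Lemma linf_normZ (a : R) f : linf_norm (a *: f) = `|a| * linf_norm f.
Proof.
apply/eqP; rewrite eq_le; apply/andP; split.
  by apply: linf_norm_le => n; rewrite normrM ler_wpM2l// linf_le.
have [->|a0] := eqVneq a 0.
  by rewrite normr0 mul0r; apply: le_trans (linf_le _ 0).
rewrite -ler_pdivlMl ?normr_gt0//; apply: linf_norm_le => n.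
by rewrite ler_pdivlMl ?normr_gt0// -normrM; exact: (linf_le (a *: f)).
Qed.

Lemma linf_norm0_eq0 f : linf_norm f = 0 -> f = 0.
Proof.
move=> f0; apply/val_inj/funext => n; apply/eqP.
by rewrite -normr_le0 -[leRHS]f0 linf_le.
Qed.

HB.instance Definition _ := Lmodule_isNormed.Build R linf
  linf_normD linf_normZ linf_norm0_eq0.

Lemma linf_complete (F : set_system linf) : ProperFilter F -> cauchy F -> cvg F.
Proof.
move=> FF cF.
have small (e : R) : 0 < e ->
    exists2 A, F A & forall x y, A x -> A y -> forall n, `|x n - y n| <= e.
  move=> e0; have /cauchy_ballP/(_ e e0) := cF.
  case=> -[A B] /= [FA FB] AB; exists (A `&` B); first exact: filterI.
  move=> x y [Ax _] [_ By] n; have := AB (x, y) (conj Ax By).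
  rewrite -ball_normE /ball_ /= => /ltW; apply: le_trans.
  exact: (linf_le (x - y)).
have coord n : cvg ((fun x : linf => x n : R) @ F).
  apply: cauchy_cvg; apply/cauchy_ballP => e e0.
  have [A FA Ae] := small (e / 2) (divr_gt0 e0 (ltr0n _ 2)).
  have FfA : F ((fun x : linf => x n : R) @^-1`
      ((fun x : linf => x n : R) @` A)).
    by apply: filterS FA => x Ax; exists x.
  exists (((fun x : linf => x n : R) @` A), ((fun x : linf => x n : R) @` A)) => //.
  move=> [_ _] [[x Ax <-] [y Ay <-]] /=; rewrite /ball /=.
  by apply: le_lt_trans (Ae _ _ Ax Ay n) _; rewrite ltr_pdivrMr// ltr_pMr// ltr1n.
pose f n : R^o := lim ((fun x : linf => x n : R) @ F).
have fA (e : R) A : F A -> (forall x y, A x -> A y -> forall n, `|x n - y n| <= e) ->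
    forall x, A x -> forall n, `|x n - f n| <= e.
  move=> FA Ae x Ax n; apply/ler_addgt0Pr => d d0.
  have /cvgrPdist_lt/(_ d d0) nf := coord n.
  have [y [Ay yf]] := filter_ex (filterI FA nf).
  rewrite -(subrK (y n) (x n)) -addrA; apply: le_trans (ler_normD _ _) _.
  by rewrite lerD ?Ae// distrC ltW.
have fb : linf_pred f.
  have [A FA Ae] := small 1 ltr01; have [x Ax] := filter_ex FA.
  apply/asboolP; exists (`|x| + 1) => n.
  rewrite -[f n](subKr (x n)); apply: le_trans (ler_normB _ _) _.
  by rewrite lerD ?(linf_le x)// (fA 1 A).
apply/cvg_ex; exists (Linf fb); apply/cvgrPdist_le => e e0.
have [A FA Ae] := small e e0; apply: filterS (FA) => x Ax.
by rewrite distrC; apply: linf_norm_le => n; exact: (fA e A).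
Qed.

HB.instance Definition _ := Uniform_isComplete.Build linf linf_complete.

End linf.

(** * The topology of C(R) through uniform bounds on the intervals [-m, m] *)

Section CR_topology.
Variable R : realType.
Implicit Types (x y : CR R) (m n : nat) (r e t : R).

Definition bnd m x r := forall t : R, `|t| <= m%:R -> `|CR_fun x t| <= r.

Lemma bndZ m x r (a : R) : bnd m x r -> bnd m (a *: x) (`|a| * r).
Proof. by move=> xr t tm; rewrite normrM ler_wpM2l// xr. Qed.

Lemma bnd_le m n x r : (m <= n)%N -> bnd n x r -> bnd m x r.
Proof. by move=> mn xr t tm; apply: xr; rewrite (le_trans tm)// ler_nat. Qed.

Lemma bnd_ex m x : exists2 r, 0 < r & bnd m x r.
Proof.
have [||c _ cP] := @EVT_max R (fun t => `|CR_fun x t|) (- m%:R) m%:R.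
- by rewrite (@le_trans _ _ 0)// oppr_le0.
- apply: continuous_subspaceT => t.
  by apply: continuous_comp; [exact: CR_continuous|exact: norm_continuous].
exists (`|CR_fun x c| + 1); first by rewrite ltr_wpDl.
move=> t tm; apply: le_trans (cP t _) _; last by rewrite lerDl.
by rewrite in_itv/= -ler_norml.
Qed.

Lemma near_bnd x m e : 0 < e -> \forall y \near x, bnd m (y - x) e.
Proof.
move=> e0; have [+ _] := @CR_cvgP R (nbhs x) x _.
move=> /(_ cvg_id) /(_ [set` `[- m%:R, m%:R]] (@segment_compact _ _ _)).
set U := [set h : R -> R | forall t, [set` `[- m%:R : R, m%:R]] t ->
   ball (CR_fun x t) e (h t)].
move=> /(_ U) Ux; have {}Ux : nbhs x (@CR_fun R @^-1` U).
  apply: Ux; rewrite (@uniform_nbhs R); exists [set p | ball p.1 e p.2].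
  by split => //; exact: entourage_ball (PosNum e0).
apply: filterS Ux => y Uy t tm.
have := Uy t; rewrite /= in_itv/= -ler_norml tm => /(_ isT).
by rewrite -ball_normE /ball_/= distrC => /ltW.
Qed.

(** Conversely the sets of [near_bnd] form a base at [x]: they generate a filter
    that converges to [x] uniformly on every compact set. *)
Lemma nbhs_bnd x (U : set (CR R)) : nbhs x U ->
  exists m, exists2 e, 0 < e & forall y, bnd m (y - x) e -> U y.
Proof.
pose D := [set p : nat * R | 0 < p.2].
pose S (p : nat * R) := [set y : CR R | bnd p.1 (y - x) p.2].
have FF : Filter (filter_from D S).
  apply: filter_from_filter; first by exists (0%N, 1); rewrite /D/= ltr01.
  move=> [m e] [n d] /= e0 d0; exists (maxn m n, Num.min e d).
    by rewrite /D/= lt_min e0.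
  move=> y /= yb; split=> t tm.
    have /yb : `|t| <= (maxn m n)%:R by rewrite (le_trans tm)// ler_nat leq_maxl.
    by rewrite /= le_min => /andP[].
  have /yb : `|t| <= (maxn m n)%:R by rewrite (le_trans tm)// ler_nat leq_maxr.
  by rewrite /= le_min => /andP[].
have : filter_from D S --> x.
  apply/CR_cvgP => K /compact_bounded [M [_ MK]] P.
  rewrite (@uniform_nbhs R) => -[E [entE EP]].
  have [e e0 eE] : exists2 e, 0 < e & forall p : R * R, ball p.1 e p.2 -> E p.
    by have := entE; rewrite -entourage_ballE => -[e e0 eE]; exists e => // p /eE.
  have [m Mm] : exists m : nat, M + 1 <= m%:R.
    exists (Num.trunc (`|M| + 1)).+1; apply: (@le_trans _ _ (`|M| + 1)).
      by rewrite lerD2r ler_norm.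
    by rewrite ltW// truncnS_gt.
  exists (m, e / 2); first by rewrite /D/= divr_gt0.
  move=> y /= yb; apply: EP => t Kt; apply: eE => /=.
  rewrite -ball_normE /ball_/= distrC.
  apply: (@le_lt_trans _ _ (e / 2)).
    by apply: yb; apply: le_trans Mm; apply: MK => //; rewrite ltrDl.
  by rewrite ltr_pdivrMr// ltr_pMr// ltr1n.
by move=> /[apply] -[[m e] /= e0 eU]; exists m, e.
Qed.

Section subspace.
Variable X : SF R.
Implicit Types u v : SF_space X.

Lemma near_bnd_sub u m e : 0 < e -> \forall v \near u, bnd m (\val (v - u)) e.
Proof.
move=> e0.
have cv : continuous (\val : SF_space X -> CR R) by exact: initial_continuous.
by have := cv u _ (near_bnd (\val u) m e0).
Qed.

Lemma nbhs0_bnd (U : set (SF_space X)) : nbhs (0 : SF_space X) U ->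
  exists m, exists2 e, 0 < e & forall v, bnd m (\val v) e -> U v.
Proof.
case=> _ [[W oW <-] W0 WU].
have /nbhs_bnd[m [e e0 eW]] : nbhs (0 : CR R) W by exact: open_nbhs_nbhs.
by exists m, e => // v ve; apply: WU; apply: eW; rewrite subr0.
Qed.

End subspace.
End CR_topology.

(** * Equicontinuity, continuity and bounds by seminorms *)

Section subspace_bounds.
Variables (R : realType) (X : SF R).
Implicit Types u v : SF_space X.

(** [dominated N m C] says that every [N i] is at most [C] times the sup norm on
    [-m, m].  Quantifying over the strict upper bounds [r] of that norm avoids a
    case distinction where the norm vanishes. *)
Definition dominated (I : Type) (N : I -> SF_space X -> R) m C :=
  forall u r, 0 < r -> bnd m (\val u) r -> forall i, N i u <= C * r.

Lemma homogeneous_dominated (I : Type) (N : I -> SF_space X -> R) :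
  (forall i (a : R) u, N i (a *: u) = `|a| * N i u) ->
  (\forall v \near (0 : SF_space X), forall i, N i v <= 1) ->
  exists m, exists2 C, 0 < C & dominated N m C.
Proof.
move=> NZ /nbhs0_bnd[m [e e0 N1]]; exists m, e^-1; first by rewrite invr_gt0.
move=> u r r0 ur i; have er : 0 < e / r by rewrite divr_gt0.
have ub : bnd m (\val ((e / r) *: u)) e.
  by have := bndZ (e / r) ur; rewrite gtr0_norm// divfK ?gt_eqF.
have := N1 _ ub i.
by rewrite NZ gtr0_norm// -ler_pdivlMl// mulr1 invf_div [r / e]mulrC.
Qed.

Lemma dominated_near (I : Type) (N : I -> SF_space X -> R) m C : 0 < C ->
  dominated N m C -> forall u e, 0 < e -> \forall v \near u, forall i, N i (v - u) < e.
Proof.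
move=> C0 NC u e e0; have d0 : 0 < e / 2 / C by rewrite !divr_gt0.
apply: filterS (near_bnd_sub u m d0) => v vu i.
apply: le_lt_trans (NC _ _ d0 vu i) _.
by rewrite mulrC divfK ?gt_eqF// ltr_pdivrMr// ltr_pMr// ltr1n.
Qed.

Lemma equicontinuous_dominated (phi : nat -> {scalar SF_space X}) :
  equicontinuous [set: nat] (fun n => phi n : SF_space X -> R) ->
  exists m, exists2 C, 0 < C & dominated (fun n u => `|phi n u|) m C.
Proof.
move=> ephi; apply: homogeneous_dominated => [i a u|].
  by rewrite linearZ normrM.
have := ephi 0 [set p | ball p.1 1 p.2] (entourage_ball _ (PosNum ltr01)).
apply: filterS => v vb i; have := vb i Logic.I.
by rewrite -ball_normE /ball_/= linear0 sub0r normrN => /ltW.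
Qed.

Lemma dominated_equicontinuous (phi : nat -> {scalar SF_space X}) m C : 0 < C ->
  dominated (fun n u => `|phi n u|) m C ->
  equicontinuous [set: nat] (fun n => phi n : SF_space X -> R).
Proof.
move=> C0 phiC u E; rewrite -entourage_ballE => -[e /= e0 eE].
apply: filterS (dominated_near C0 phiC u e0) => v vu i _; apply: eE => /=.
by rewrite -ball_normE /ball_/= distrC -linearB.
Qed.

Lemma continuous_dominated (Y : normedModType R) (T : {linear SF_space X -> Y}) :
  continuous T ->
  exists m, exists2 C, 0 < C & dominated (fun _ : unit => fun u => `|T u|) m C.
Proof.
move=> cT; apply: homogeneous_dominated => [i a u|].
  by rewrite linearZ normrZ.
have /cvgrPdist_le/(_ _ ltr01) := cT 0.
by apply: filterS => v; rewrite linear0 sub0r normrN.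
Qed.

Lemma dominated_continuous (Y : normedModType R) (T : {linear SF_space X -> Y}) m C :
  0 < C -> dominated (fun _ : unit => fun u => `|T u|) m C -> continuous T.
Proof.
move=> C0 TC u.
have FF : Filter (nbhs u) by exact: nbhs_filter.
apply/(@cvgrPdist_lt R Y _ (nbhs u) FF) => e e0.
apply: filterS (dominated_near C0 TC u e0) => v vu.
by rewrite distrC -linearB; exact: (vu tt).
Qed.

(** * Nuclear spaces have small minors *)

Section to_linf.
Variables (phi : nat -> {scalar SF_space X}) (m : nat) (C : R).
Hypothesis phiC : dominated (fun n u => `|phi n u|) m C.

Lemma family_bounded u : linf_pred (fun n => phi n u).
Proof.
have [r r0 ur] := bnd_ex m (\val u).
by apply/asboolP; exists (C * r) => n; exact: (phiC r0 ur).
Qed.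

Definition to_linf u : linf R := Linf (family_bounded u).

Lemma to_linf_linear : linear to_linf.
Proof. by move=> a u v; apply/val_inj/funext => n /=; rewrite linearP. Qed.

HB.instance Definition _ :=
  GRing.isLinear.Build R (SF_space X) (linf R) *:%R to_linf to_linf_linear.

Lemma to_linf_dominated : dominated (fun _ : unit => fun u => `|to_linf u|) m C.
Proof. by move=> u r r0 ur _; apply: linf_norm_le => n; exact: (phiC r0 ur). Qed.

End to_linf.

(** Nuclearity applied to [to_linf], read coordinatewise: a single series
    represents all the functionals [phi j] at once, in terms of another
    equicontinuous sequence [psi].  It can therefore be iterated, without having
    to extend functionals from a subspace. *)
Lemma nuclear_factor (phi : nat -> {scalar SF_space X}) m C :
  nuclear_space (SF_space X) -> 0 < C ->
  dominated (fun n u => `|phi n u|) m C ->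
  exists (l : R^nat) (psi : nat -> {scalar SF_space X}) (y : nat -> R^nat)
      (L D : R),
    [/\ equicontinuous [set: nat] (fun n => psi n : SF_space X -> R),
      (forall N, \sum_(n < N) `|l n| <= L), 0 < D,
      (forall n j, `|y n j| <= D) &
      (forall u j, (fun N => \sum_(n < N) l n * psi n u * y n j) @ \oo --> phi j u)].
Proof.
move=> nuc C0 phiC; pose T := to_linf phiC.
have cT : continuous T.
  exact: (@dominated_continuous _ T m C C0 (to_linf_dominated phiC)).
have [l [psi [y [cl epsi yb sy]]]] := nuc _ T cT.
exists l, psi, (fun n => y n : nat -> R), (limn [normed series l]).
have [D D0 yD] : exists2 D, 0 < D & forall n, `|y n| <= D.
  have [M [_ My]] := yb; exists (`|M| + 1); first by rewrite ltr_wpDl.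
  move=> n; apply: (My (`|M| + 1)); last by exists n.
  by rewrite ltr_pwDr// ler_norm.
exists D; split=> //.
- move=> N; rewrite -(big_mkord xpredT (fun n => `|l n|)).
  apply: (nondecreasing_cvgn_le _ cl N); apply/nondecreasing_series => n _ _.
  exact: normr_ge0.
- by move=> n j; apply: le_trans (yD n); exact: linf_le.
- move=> u j; apply/cvgrPdist_lt => e e0.
  have /cvgrPdist_lt/(_ e e0) := sy u; apply: filterS => N.
  apply: le_lt_trans; apply: le_trans (linf_le _ j).
  have -> : \sum_(n < N) l n * psi n u * y n j =
      series (fun n => (l n * psi n u) *: y n) N j.
    rewrite /series /= -(big_mkord xpredT (fun n => l n * psi n u * y n j)).
    by apply: (big_ind2 (fun (a : R) (b : linf R) => a = b j)) => // _ a _ b -> ->.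
  exact: lexx.
Qed.

(** After [q] applications of [nuclear_factor] the matrix of the [phi (t j) (x i)]
    is a product of [q.+1] matrices with bounded entries, separated by [q]
    summable diagonals.  Hadamard's inequality bounds the minors of each factor by
    a geometric term times the square root of [k ^ k], and [ler_det_mul_diag]
    gains [1 / k`!] for each diagonal.  The bounds for the finite truncations of
    the series do not depend on the truncation, hence pass to the limit. *)
Lemma nuclear_minors_le q (phi : nat -> {scalar SF_space X}) :
  nuclear_space (SF_space X) ->
  equicontinuous [set: nat] (fun n => phi n : SF_space X -> R) ->
  exists m, exists2 C, 0 < C & forall k (x : 'I_k -> SF_space X) (t : 'I_k -> nat),
    (forall i, bnd m (\val (x i)) 1) ->
    `|\det (\matrix_(i, j) phi (t j) (x i))| * k`!%:R ^+ q <=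
      C ^+ k * Num.sqrt (k ^ k)%:R ^+ q.+1.
Proof.
move=> nuc; elim: q => [|q IH] in phi *; move=> /equicontinuous_dominated[m [C C0 phiC]].
  exists m, C => // k x t x1; rewrite expr0 mulr1 expr1.
  apply: hadamard_scaled => // i j; rewrite mxE -[C]mulr1.
  exact: (phiC _ _ ltr01 (x1 i)).
have [l [psi [y [L [D [epsi lL D0 yD phiE]]]]]] := nuclear_factor nuc C0 phiC.
have [{phiC}m' [C' C'0 psiC]] := IH _ epsi.
have L0 : 0 <= L by have := lL 0%N; rewrite big_ord0.
exists m', ((L + 1) * C' * D); first by rewrite !mulr_gt0// ltr_wpDl.
move=> k x t x1.
set v := Num.sqrt _; have v0 : 0 <= v by exact: sqrtr_ge0.
pose M N : 'M[R]_k := \matrix_(i, j) \sum_(n < N) l n * psi n (x i) * y n (t j).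
have Mcvg : (fun N => \det (M N)) @ \oo --> \det (\matrix_(i, j) phi (t j) (x i)).
  apply: det_cvg => i j; rewrite mxE.
  rewrite (_ : (fun N => M N i j) = fun N => \sum_(n < N) l n * psi n (x i) * y n (t j)).
    exact: phiE.
  by apply/funext => N; rewrite mxE.
have fact_gt0R : 0 < k`!%:R :> R by rewrite ltr0n fact_gt0.
pose a := C' ^+ k * v ^+ q.+1 / k`!%:R ^+ q.
pose b := D ^+ k * v.
have Mb N : `|\det (M N)| <= L ^+ k * a * b / k`!%:R.
  rewrite ler_pdivlMr// mulr_natr.
  have -> : M N = \matrix_(i, j) \sum_(n < N) l n *
      (\matrix_(i < k, n < N) psi n (x i)) i n * (\matrix_(n < N, j < k) y n (t j)) n j.
    by apply/matrixP => i j; rewrite !mxE; apply: eq_bigr => n _; rewrite !mxE.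
  apply: ler_det_mul_diag => [|||f|f].
  - by rewrite divr_ge0 ?mulr_ge0 ?exprn_ge0// ltW.
  - by rewrite mulr_ge0 ?exprn_ge0// ltW.
  - exact: lL.
  - have := psiC k x f x1; rewrite -ler_pdivlMr ?exprn_gt0//.
    apply: le_trans; rewrite le_eqVlt; apply/orP; left; apply/eqP.
    by congr (`|\det _|); apply/matrixP => i j; rewrite !mxE.
  - by apply: hadamard_scaled => // i j; rewrite !mxE.
have lim_le : `|\det (\matrix_(i, j) phi (t j) (x i))| <= L ^+ k * a * b / k`!%:R.
  apply: (closed_cvg (fun z => z <= L ^+ k * a * b / k`!%:R) _ _ _ (cvg_norm Mcvg)).
    exact: closed_le.
  by near=> N; exact: Mb.
rewrite -ler_pdivlMr ?exprn_gt0//; apply: le_trans lim_le _.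
have -> : L ^+ k * a * b / k`!%:R =
    (L ^+ k * C' ^+ k * D ^+ k) * v ^+ q.+2 / k`!%:R ^+ q.+1.
  rewrite /a /b (exprS k`!%:R q) (exprSr v q.+1).
  by field; rewrite !gt_eqF// exprn_gt0.
rewrite ler_pM2r ?invr_gt0 ?exprn_gt0// ler_wpM2r ?exprn_ge0//.
rewrite -!exprMn; apply: lerXn2r;
  rewrite ?nnegrE ?mulr_ge0 ?addr_ge0 ?(ltW C'0) ?(ltW D0)//.
by rewrite ler_pM2r// ler_pM2r// lerDl.
Unshelve. all: by end_near. Qed.
End subspace_bounds.

(** * Auxiliary series *)

(** The indices [n] with [dlog n = j] form the [j]-th dyadic block, which has
    [2 ^ j] elements, and [doff n] is the position of [n] in its block. *)
Definition dlog n := trunc_log 2 n.+1.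
Definition doff n := (n.+1 - 2 ^ dlog n)%N.

Lemma dlogP n : (2 ^ dlog n <= n.+1 < 2 ^ (dlog n).+1)%N.
Proof. exact: trunc_log_bounds. Qed.

Lemma big_dyadic (Y : nmodType) (z : nat -> nat -> Y) J :
  \sum_(0 <= n < (2 ^ J).-1) z (dlog n) (doff n) =
  \sum_(0 <= j < J) \sum_(0 <= b < 2 ^ j) z j b.
Proof.
elim: J => [|J IH]; first by rewrite !big_geq.
rewrite big_nat_recr//= -IH.
have J0 : (0 < 2 ^ J)%N by rewrite expn_gt0.
rewrite (@big_cat_nat _ _ _ (2 ^ J).-1)//=; last by rewrite expnS; lia.
congr (_ + _); rewrite -{1}[(2 ^ J).-1]add0n big_addn.
have -> : ((2 ^ J.+1).-1 - (2 ^ J).-1 = 2 ^ J)%N by rewrite expnS; lia.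
apply: eq_big_nat => b /andP[_ bJ].
have dE : dlog (b + (2 ^ J).-1) = J.
  by apply: trunc_log_eq => //; rewrite expnS; apply/andP; split; lia.
by rewrite /doff dE; congr (z _ _); lia.
Qed.

Lemma cvg_series_dominated (R : realType) (Y : completeNormedModType R)
    (w : nat -> Y) (l : R^nat) :
  (forall n, `|w n| <= l n) -> cvgn (series l) -> cvgn (series w).
Proof.
move=> wl cl; apply: normed_cvg.
by apply: (series_le_cvg _ _ _ cl) => n //=; exact: le_trans (wl n).
Qed.

Lemma cvg_inv_sqr (R : realType) :
  cvgn (series (fun n => (n.+1%:R ^+ 2)^-1 : R)).
Proof.
have b0 (n : nat) : 0 <= (n.+1%:R ^+ 2)^-1 :> R by rewrite invr_ge0 exprn_ge0.
apply: nondecreasing_is_cvgn; first by apply/nondecreasing_series => n _ _.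
exists 2 => _ [[|N] _ <-]; rewrite /series /=; first by rewrite big_geq.
suff: \sum_(0 <= n < N.+1) (n.+1%:R ^+ 2)^-1 <= 2 - N.+1%:R^-1 :> R.
  by move=> /le_trans; apply; rewrite gerBl invr_ge0.
elim: N => [|N IH]; first by rewrite big_nat1 expr1n invr1; lra.
rewrite big_nat_recr//=; apply: le_trans (lerD IH (lexx _)) _.
have N0 : 0 < N.+1%:R :> R by [].
rewrite -subr_ge0 -[N.+2]addn1 natrD; set x : R := N.+1%:R in N0 *.
have -> : 2 - (x + 1)^-1 - (2 - x^-1 + ((x + 1) ^+ 2)^-1) = (x * (x + 1) ^+ 2)^-1.
  by field; rewrite !gt_eqF// ltr_wpDl// ltW.
by rewrite invr_ge0 mulr_ge0 ?exprn_ge0// ?addr_ge0 ?ltW.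
Qed.

(** * A countable dense set of sampling points *)

Section points.
Variable R : realType.

(** [pt n] enumerates the rational points of [-n, n]; the indices that do not
    encode such a point are sent to [0], which belongs to the interval. *)
Definition pt (n i : nat) : R :=
  if unpickle i is Some q
  then if `|ratr q : R| <= n%:R then ratr (q : rat) else 0 else 0.

Lemma pt_le n i : `|pt n i| <= n%:R.
Proof.
rewrite /pt; case: unpickle => [q|]; last by rewrite normr0.
by case: ifP => //; rewrite normr0.
Qed.

Lemma bnd_pt n (x : CR R) r : (forall i, `|CR_fun x (pt n i)| <= r) -> bnd n x r.
Proof.
move=> xr t tn; apply/ler_addgt0Pr => e e0.
have [q [qn xq]] : exists q : rat, `|ratr q : R| <= n%:R /\
      `|CR_fun x t - CR_fun x (ratr q)| < e.
  have /cvgrPdist_lt/(_ e e0)/nbhs_ballP[d /= d0 dB] := @CR_continuous R x t.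
  have [t0|t0|t0] := ltgtP t 0.
  - have [q] : exists q : rat, ratr q \in `](t), (Num.min 0 (t + d))[ .
      by apply: rat_in_itvoo; rewrite lt_min t0 ltrDl.
    rewrite in_itv/= lt_min => /and3P[tq q0 qd]; exists q; split.
      by apply: le_trans tn; rewrite !ltr0_norm// lerN2 ltW.
    by apply: dB; rewrite -ball_normE /ball_/= ltr_distlC; apply/andP; split; lra.
  - have [q] : exists q : rat, ratr q \in `](Num.max 0 (t - d)), t[ .
      by apply: rat_in_itvoo; rewrite gt_max t0 gtrBl.
    rewrite in_itv/= gt_max => /andP[/andP[q0 qd] qt]; exists q; split.
      by apply: le_trans tn; rewrite !gtr0_norm// ltW.
    by apply: dB; rewrite -ball_normE /ball_/= ltr_distlC; apply/andP; split; lra.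
  - by exists 0; rewrite rmorph0 normr0 t0 subrr normr0.
have := xr (pickle q); rewrite /pt pickleK qn => xq'.
rewrite -(subrK (CR_fun x (ratr q)) (CR_fun x t)) addrC.
by apply: le_trans (ler_normD _ _) _; rewrite lerD// ltW.
Qed.

End points.

(** * A determinantal condition equivalent to nuclearity *)

Section decay.
Variable R : realType.

(** The interior makes this ball open, as needed to test it with the generators of
    the Effros structure. *)
Definition unit_nbhs m : set (CR R) := [set x | bnd m x 1]^°.

(** The minors of the identity of [X], from the sup norm on [-m, m] to the one on
    [-n, n], stand in for its approximation numbers.  The exponent of [k] has to
    exceed [1]; with the value [2] the series [\sum_j 2 ^ j / (2 ^ j) ^ 2] met in
    [det_decay_nuclear] converges. *)
Definition det_decay (X : SF R) := forall n, exists m C : nat,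
  forall k (t : 'I_k -> nat) (x : 'I_k -> CR R),
    (forall i, SF_set X (x i) /\ unit_nbhs m (x i)) ->
    `|\det (\matrix_(i, j) CR_fun (x i) (pt R n (t j)))| <= (C%:R / k%:R ^+ 2) ^+ k.

Lemma half_unit_nbhs m x : bnd m x (1 / 2) -> unit_nbhs m x.
Proof.
move=> x1; apply: filterS (near_bnd x m (divr_gt0 ltr01 (ltr0n R 2))) => y yx t tm.
have := lerD (yx t tm) (x1 t tm); rewrite -splitr; apply: le_trans.
by rewrite -[CR_fun y t](subrK (CR_fun x t)); exact: ler_normD.
Qed.

Variable X : SF R.
Implicit Types u v : SF_space X.

Definition ev_pt n (i : nat) (u : SF_space X) : R := CR_fun (\val u) (pt R n i).

Lemma ev_pt_linear n i : scalar (ev_pt n i).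
Proof. by move=> a u v. Qed.

HB.instance Definition _ n i :=
  GRing.isLinear.Build R (SF_space X) R *%R (ev_pt n i) (ev_pt_linear n i).

(** Five applications of nuclearity give a bound of order
    [(k ^ k) ^ 3 / k`! ^ 5] up to a geometric factor, and [k ^ k / k`!] is at most
    the [k]-th power of the base of the exponential; what remains is
    [(k ^ k) ^ -2]. *)
Lemma nuclear_det_decay : nuclear_space (SF_space X) -> det_decay X.
Proof.
move=> nuc n.
have edom : dominated (fun i u => `|ev_pt n i u|) n 1.
  by move=> u r r0 ur i; rewrite mul1r; apply: ur; exact: pt_le.
have eeq := @dominated_equicontinuous _ _ (fun i => ev_pt n i) _ _ ltr01 edom.
have [m [C C0 Cd]] := @nuclear_minors_le _ X 5 (fun i => ev_pt n i) nuc eeq.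
have [D CD] : exists D : nat, C * expR 1 ^+ 5 <= D%:R.
  by exists (Num.trunc (C * expR 1 ^+ 5)).+1; rewrite ltW// truncnS_gt.
exists m, D => k t x x1.
have [k0|k0] := posnP k.
  by move: t x x1; rewrite k0 => t x x1; rewrite det_mx00 normr1 expr0.
pose u i : SF_space X := exist _ (x i) (mem_set (x1 i).1).
have := Cd k u t (fun i => interior_subset (x1 i).2).
rewrite (_ : \matrix_(i, j) _ = \matrix_(i, j) CR_fun (x i) (pt R n (t j))); last first.
  by apply/matrixP => i j; rewrite !mxE.
have kk0 : 0 < (k ^ k)%:R :> R by rewrite ltr0n expn_gt0 k0.
have kR0 : 0 < k%:R :> R by rewrite ltr0n.
have f0 : 0 < k`!%:R :> R by rewrite ltr0n fact_gt0.
have fk : (k ^ k)%:R / k`!%:R <= expR 1 ^+ k :> R.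
  rewrite -expRM_natl mulr1 natrX; case: (k) k0 => // k' _.
  by apply: le_trans (expR_ge1Dxn k' (ler0n R _)); rewrite lerDr.
rewrite (exprM _ 2 3) sqr_sqrtr ?(ltW kk0)// -ler_pdivlMr ?exprn_gt0//.
move=> /le_trans; apply.
have -> : C ^+ k * (k ^ k)%:R ^+ 3 / k`!%:R ^+ 5 =
    C ^+ k * ((k ^ k)%:R / k`!%:R) ^+ 5 / (k ^ k)%:R ^+ 2.
  by field; rewrite !gt_eqF.
have -> : (D%:R / k%:R ^+ 2) ^+ k = D%:R ^+ k / (k ^ k)%:R ^+ 2 :> R.
  by rewrite exprMn exprVn natrX -!exprM mulnC.
rewrite ler_pM2r ?invr_gt0 ?exprn_gt0//.
apply: (@le_trans _ _ ((C * expR 1 ^+ 5) ^+ k)).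
  rewrite [leRHS]exprMn ler_pM2l ?exprn_gt0// exprAC.
  by apply: lerXn2r => //; rewrite nnegrE ?exprn_ge0 ?expR_ge0// divr_ge0// ltW.
by rewrite lerXn2r ?nnegrE// mulr_ge0 ?exprn_ge0 ?expR_ge0 ?ltW.
Qed.

Hypothesis decay : det_decay X.

(** The inclusion of seminorms is approximated, up to [C / k ^ 2], by operators of
    rank less than [k] that only use finitely many samples of their argument.
    The points [t] and elements [L] are indexed by [nat], not by ['I_s], so that
    choice can pick them for all [k] at once. *)
Lemma approximation n : exists m, exists2 C, 0 < C & forall k, (0 < k)%N ->
  exists s (t : nat -> nat) (L : nat -> SF_space X), (s < k)%N /\
  forall u r, 0 < r -> bnd m (\val u) r ->
    bnd n (\val (u - \sum_(i < s) ev_pt n (t i) u *: L i)) (C / k%:R ^+ 2 * r).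
Proof.
have [m [C decayC]] := decay n.
(* the successor makes the constant positive when [C = 0] *)
exists (maxn m n), (4 * C.+1%:R); first by rewrite mulr_gt0.
(* the radius [1 / 2] puts [B] inside the open ball of [det_decay] *)
move=> k k0; pose B := [set u : SF_space X | bnd (maxn m n) (\val u) (1 / 2)].
have kR0 : 0 < k%:R ^+ 2 :> R by rewrite exprn_gt0// ltr0n.
have B1 u t : B u -> `|ev_pt n t u| <= 1.
  move=> Bu; apply: (@le_trans _ _ (1 / 2)); last by rewrite ler_pdivrMr// mul1r ler1n.
  by apply: (bnd_le (leq_maxr m n) Bu); exact: pt_le.
have [||x t Bx|s [t [L [sk L2 tL]]]] :=
    @pivoting R _ nat (fun i => ev_pt n i) B B1 (C%:R / k%:R ^+ 2) k.
- exact: k0.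
- by rewrite divr_ge0// ltW.
- have := decayC k t (fun i => \val (x i)) _.
  rewrite (_ : \matrix_(i, j) _ = evmx (fun i => ev_pt n i) x t); last first.
    by apply/matrixP => i j; rewrite !mxE.
  apply=> i; split; first by have := valP (x i); rewrite inE.
  by apply: half_unit_nbhs; exact: (bnd_le (leq_maxl m n) (Bx i)).
pose t' i := if insub i is Some j then t j else 0%N.
pose L' i := if insub i is Some j then L j else 0.
exists s, t', L'; split=> // u r r0 ur; apply: bnd_pt => i.
have Bu : B ((2 * r)^-1 *: u).
  have := bndZ (2 * r)^-1 ur; rewrite gtr0_norm ?invr_gt0 ?mulr_gt0//.
  by rewrite /B/= (_ : (2 * r)^-1 * r = 1 / 2)//; field; rewrite gt_eqF.
have evE : ev_pt n i (u - \sum_(i < s) ev_pt n (t' i) u *: L' i) =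
    ev_pt n i u - \sum_j ev_pt n (t j) u * ev_pt n i (L j).
  rewrite linearB; congr (_ - _); rewrite linear_sum; apply: eq_bigr => j _.
  by rewrite linearZ/= /t' /L' valK.
have := tL _ i Bu; rewrite -[CR_fun _ _]/(ev_pt n i _) evE linearZ/=.
rewrite (eq_bigr (fun j => (2 * r)^-1 * (ev_pt n (t j) u * ev_pt n i (L j)))); last first.
  by move=> j _; rewrite linearZ/= mulrA.
rewrite -mulr_sumr -mulrBr normrM gtr0_norm ?invr_gt0 ?mulr_gt0//.
rewrite ler_pdivrMl ?mulr_gt0//.
move=> /le_trans; apply.
have -> : 2 * r * (2 * (C%:R / k%:R ^+ 2)) = 4 * C%:R / k%:R ^+ 2 * r by ring.
by rewrite ler_pM2r// ler_pM2r ?invr_gt0// ler_pM2l// ler_nat.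
Qed.

End decay.

(** * From the decay of minors to nuclear operators *)

Section decay_nuclear.
Variables (R : realType) (X : SF R).
Implicit Types u v : SF_space X.

Section finite_rank.
Variables (n s1 s2 : nat) (t1 t2 : nat -> nat) (L1 L2 : nat -> SF_space X).

Definition sampling s (t : nat -> nat) (L : nat -> SF_space X) u :=
  \sum_(i < s) ev_pt n (t i) u *: L i.

Lemma sampling_linear s t L : linear (sampling s t L).
Proof.
move=> a u v; rewrite /sampling scaler_sumr -big_split; apply: eq_bigr => i _.
by rewrite /= linearP scalerDl scalerA.
Qed.

HB.instance Definition _ s t L :=
  GRing.isLinear.Build R (SF_space X) (SF_space X) *:%R (sampling s t L)
    (sampling_linear s t L).

Let A u := sampling s2 t2 L2 u - sampling s1 t1 L1 u.

Let A_linear : linear A.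
Proof. by move=> a u v; rewrite /A !linearP/= addrACA -scalerDr. Qed.

Let evA i u := ev_pt n i (A u).

Let evA_linear i : scalar (evA i).
Proof. by move=> a u v; rewrite /evA A_linear linearP. Qed.

HB.instance Definition _ i :=
  GRing.isLinear.Build R (SF_space X) R *%R (evA i) (evA_linear i).

(** The difference [A] of two operators as in [approximation] has rank at most
    [s1 + s2], so its minors of size [(s1 + s2).+1] vanish and [pivoting] applies
    with [g = 0]: on [-n, n] the operator is a sum of at most [s1 + s2] terms
    [ev_pt n (t j) (A u) *: A (L j)], each of which is controlled by the size of
    [A u]. *)
Lemma auerbach : exists s (t : nat -> nat) (L : nat -> SF_space X),
  [/\ (s <= s1 + s2)%N, (forall j, bnd n (\val (A (L j))) 2) &
   forall u r, 0 < r ->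
     bnd n (\val (A u - \sum_(j < s) ev_pt n (t j) (A u) *: A (L j))) r].
Proof.
pose B := [set u | forall i, `|evA i u| <= 1].
have B1 u i : B u -> `|evA i u| <= 1 by apply.
have [||x t _|s [t [L [sN L2' tL]]]] :=
  @pivoting R _ nat evA B B1 0 (s1 + s2).+1.
- by [].
- by [].
- rewrite (_ : evmx _ _ _ =
    row_mx (\matrix_(a < (s1 + s2).+1, i < s1) - ev_pt n (t1 i) (x a))
      (\matrix_(a < (s1 + s2).+1, i < s2) ev_pt n (t2 i) (x a)) *m
    col_mx (\matrix_(i < s1, b < (s1 + s2).+1) ev_pt n (t b) (L1 i))
      (\matrix_(i < s2, b < (s1 + s2).+1) ev_pt n (t b) (L2 i))).
    by rewrite det_mulmx_thin// normr0 expr0n.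
  apply/matrixP => a b; rewrite mul_row_col !mxE /= /evA /A linearB addrC.
  rewrite /sampling !linear_sum; congr (_ + _); apply: eq_bigr => i _.
    by rewrite linearZ/= !mxE.
  by rewrite !mxE mulNr; congr (- _); rewrite linearZ.
pose t' i := if insub i is Some j then t j else 0%N.
pose L' i := if insub i is Some j then L j else 0.
have A0 : A 0 = 0 by rewrite /A !linear0 addr0.
exists s, t', L'; split=> //.
  move=> j; apply: bnd_pt => i; rewrite /L'; case: insub => [j'|]; first exact: L2'.
  by rewrite A0 normr0.
move=> u r r0; apply: bnd_pt => i.
have [M M0 uM] := bnd_ex n (\val (A u)).
have Bu : B (M^-1 *: u).
  move=> i'; rewrite linearZ/= normrM gtr0_norm ?invr_gt0// ler_pdivrMl// mulr1.
  by apply: uM; exact: pt_le.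
have := tL _ i Bu; rewrite mulr0 linearZ/=.
rewrite (eq_bigr (fun j => M^-1 * (evA (t j) u * evA i (L j)))); last first.
  by move=> j _; rewrite linearZ/= mulrA.
rewrite -mulr_sumr -mulrBr normr_le0 mulf_eq0 invr_eq0 gt_eqF//= => /eqP e0.
apply: le_trans (ltW r0); rewrite normr_le0; apply/eqP; rewrite -[RHS]e0.
rewrite -[LHS]/(ev_pt n i (A u - \sum_(j < s) ev_pt n (t' j) (A u) *: A (L' j))).
rewrite linearB; congr (_ - _).
rewrite linear_sum; apply: eq_bigr => j _.
by rewrite linearZ/= /t' /L' valK.
Qed.

End finite_rank.

(** The operator [T] is the telescoping sum of the [T \o A j], where
    [A j = Q j.+1 - Q j] and [Q j] has rank less than [(2 ^ j %/ 4).+1], hence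
    [Q 0 = 0] and [A j] has rank at most [2 ^ j].  Since [A j] has size of order
    [(2 ^ j) ^ -2], the [2 ^ j] terms given by [auerbach] have nuclear norms that
    add up to a quantity of order [2 ^ - j].  They are laid out on the [j]-th
    dyadic block, padded with zeros, and carry the weights
    [l k = (k.+1 ^ 2)^-1], comparable to [(2 ^ j) ^ -2] on that block.  The
    series converges absolutely, so that its limit is read off at the ends of the
    blocks, where the partial sums are [T (Q J u)]. *)
Lemma det_decay_nuclear : det_decay X -> nuclear_space (SF_space X).
Proof.
move=> decay Y T /continuous_dominated[n [c c0 Tc]].
have {Tc} Tn u r : 0 < r -> bnd n (\val u) r -> `|T u| <= c * r.
  by move=> r0 ur; exact: (Tc u r r0 ur tt).
have [m [C C0 appr]] := approximation decay n.
pose kk j := (2 ^ j %/ 4).+1.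
have kk4 j : (2 ^ j <= 4 * kk j)%N by rewrite /kk; lia.
have /choice[f fP] : forall j, exists q : nat * (nat -> nat) * (nat -> SF_space X),
    (q.1.1 < kk j)%N /\ forall u r, 0 < r -> bnd m (\val u) r ->
    bnd n (\val (u - sampling n q.1.1 q.1.2 q.2 u)) (C / (kk j)%:R ^+ 2 * r).
  by move=> j; have [s [t [L H]]] := appr (kk j) (ltn0Sn _); exists (s, t, L).
pose Q j := sampling n (f j).1.1 (f j).1.2 (f j).2.
have Qerr j u r : 0 < r -> bnd m (\val u) r ->
    bnd n (\val (u - Q j u)) (16 * C / (2 ^ j)%:R ^+ 2 * r).
  move=> r0 ur t tn; apply: le_trans ((fP j).2 u r r0 ur t tn) _.
  rewrite ler_pM2r//.
  have k0 : 0 < (kk j)%:R ^+ 2 :> R by rewrite exprn_gt0.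
  have p0 : 0 < (2 ^ j)%:R ^+ 2 :> R by rewrite exprn_gt0// ltr0n expn_gt0.
  rewrite ler_pdivrMr// mulrAC ler_pdivlMr// -mulrA mulrCA ler_pM2l//.
  rewrite (_ : 16 * (kk j)%:R ^+ 2 = (4 * kk j)%:R ^+ 2); last by rewrite natrM; ring.
  by apply: lerXn2r; rewrite ?nnegrE// ler_nat.
pose A j u := Q j.+1 u - Q j u.
have A_linear j : linear (A j).
  by move=> a u v; rewrite /A /Q !linearP/= addrACA -scalerDr.
have Ale j u r : 0 < r -> bnd m (\val u) r ->
    bnd n (\val (A j u)) (32 * C / (2 ^ j)%:R ^+ 2 * r).
  move=> r0 ur t tn.
  have -> : A j u = (u - Q j u) - (u - Q j.+1 u) by rewrite opprB addrC addrA subrK.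
  apply: (@le_trans _ _ (`|CR_fun (\val (u - Q j u)) t| +
    `|CR_fun (\val (u - Q j.+1 u)) t|)); first exact: ler_normB.
  apply: le_trans (lerD (Qerr j u r r0 ur t tn) (Qerr j.+1 u r r0 ur t tn)) _.
  rewrite -mulrDl ler_pM2r//.
  rewrite (_ : 32 * C / _ = 16 * C / (2 ^ j)%:R ^+ 2 + 16 * C / (2 ^ j)%:R ^+ 2).
    rewrite lerD2l ler_pM2l ?mulr_gt0// lef_pV2 ?posrE ?exprn_gt0 ?ltr0n ?expn_gt0//.
    by rewrite -!natrX ler_nat leq_exp2r// leq_exp2l.
  by rewrite -mulrDl -mulrDl; congr (_ * _ / _); rewrite -natrD.
have /choice[g gP] : forall j, exists q : nat * (nat -> nat) * (nat -> SF_space X),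
  [/\ (q.1.1 <= 2 ^ j)%N, (forall b, bnd n (\val (A j (q.2 b))) 2) &
   forall u, T (A j u) = \sum_(b < q.1.1) ev_pt n (q.1.2 b) (A j u) *: T (A j (q.2 b))].
  move=> j; have [s [t [L [sle L2 AL]]]] := auerbach n (f j).1.1 (f j.+1).1.1
     (f j).1.2 (f j.+1).1.2 (f j).2 (f j.+1).2.
  exists (s, t, L); split=> //=.
    apply: leq_trans sle _.
    have := (fP j).1; have := (fP j.+1).1; rewrite /kk expnS; lia.
  move=> u; set S := \sum_(b < s) _; apply/eqP.
  have TE : T (A j u - \sum_(b < s) ev_pt n (t b) (A j u) *: A j (L b)) = T (A j u) - S.
    by rewrite linearB linear_sum; congr (_ - _); apply: eq_bigr => b _; rewrite linearZ.
  rewrite -subr_eq0 -normr_le0 -TE; apply/ler_addgt0Pr => e e0; rewrite add0r.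
  have ec : 0 < e / c by rewrite divr_gt0.
  by have := Tn _ _ ec (AL u _ ec); rewrite mulrC divfK ?gt_eqF.
pose F j b u := if (b < (g j).1.1)%N then ev_pt n ((g j).1.2 b) (A j u) else 0.
have F_linear j b : scalar (F j b).
  move=> a u v; rewrite /F; case: ifP => _; last by rewrite mulr0 addr0.
  by rewrite A_linear linearP.
pose z j b := T (A j ((g j).2 b)).
have zc j b : `|z j b| <= c * 2 by apply: Tn => //; have [_ + _] := gP j; exact.
pose l k : R := (k.+1%:R ^+ 2)^-1.
have phi_linear k : scalar (fun u => k.+1%:R ^+ 2 * F (dlog k) (doff k) u).
  by move=> a u v; rewrite F_linear mulrDr mulrCA.
pose phi k : {scalar SF_space X} :=
  HB.pack (fun u => k.+1%:R ^+ 2 * F (dlog k) (doff k) u)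
   (GRing.isLinear.Build R (SF_space X) R *%R _ (phi_linear k)).
have phi_dom : dominated (fun k u => `|phi k u|) m (128 * C).
  move=> u r r0 ur k /=.
  have [/andP[_ klt] j0] := (dlogP k, expn_gt0 2 (dlog k)).
  set j := dlog k in klt j0 *; have p0 : 0 < (2 ^ j)%:R ^+ 2 :> R.
    by rewrite exprn_gt0// ltr0n.
  have Fle : `|F j (doff k) u| <= 32 * C / (2 ^ j)%:R ^+ 2 * r.
    rewrite /F; case: ifP => _; first by apply: Ale => //; exact: pt_le.
    by rewrite normr0 !mulr_ge0 ?invr_ge0 ?exprn_ge0// ltW.
  rewrite normrM ger0_norm ?exprn_ge0//.
  apply: le_trans (ler_wpM2l _ Fle) _; first by rewrite exprn_ge0.
  set P := (2 ^ j)%:R ^+ 2 in p0 *.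
  rewrite [leLHS](_ : _ = 32 * C * r * (k.+1%:R ^+ 2 / P)); last by ring.
  rewrite (_ : 128 * C * r = 32 * C * r * 4); last by ring.
  rewrite ler_pM2l ?mulr_gt0// ler_pdivrMr// (_ : 4 * P = (2 ^ j.+1)%:R ^+ 2).
    by apply: lerXn2r; rewrite ?nnegrE// ler_nat ltnW.
  by rewrite /P expnS natrM; ring.
exists l, phi, (fun k => z (dlog k) (doff k)).
have cl : cvgn (series l) by exact: cvg_inv_sqr.
split.
- have -> : [normed series l] = series l.
    apply/funext => N; apply: eq_bigr => k _.
    by rewrite /= ger0_norm// invr_ge0 exprn_ge0.
  exact: cl.
- apply: (dominated_equicontinuous _ phi_dom); by rewrite mulr_gt0.
- exists (c * 2); split; first exact: num_real.
  by move=> x /ltW xc _ [k _ <-]; exact: le_trans (zc _ _) xc.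
- move=> u.
  set w := (fun k => (l k * phi k u) *: _).
  have wE k : w k = F (dlog k) (doff k) u *: z (dlog k) (doff k).
    by rewrite /w /l /= mulKf// expf_neq0.
  have [r r0 ur] := bnd_ex m (\val u).
  have cw : cvgn (series w).
    apply: (@cvg_series_dominated _ _ _ (fun k => 128 * C * r * (c * 2) * l k)).
      move=> k; rewrite /w normrZ normrM [`|l k|]ger0_norm ?invr_ge0 ?exprn_ge0//.
      rewrite mulrC [leRHS]mulrC mulrCA; apply: ler_wpM2l.
        by rewrite invr_ge0 exprn_ge0.
      by rewrite mulrC; apply: ler_pM => //; exact: phi_dom.
    exact: is_cvg_seriesZ.
  have sE J : series w (2 ^ J).-1 = T (Q J u).
    rewrite /series /= (eq_bigr _ (fun k _ => wE k)).
    rewrite (big_dyadic (fun j b => F j b u *: z j b)).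
    transitivity (\sum_(0 <= j < J) (T (Q j.+1 u) - T (Q j u))).
      apply: eq_bigr => j _; have [sj _ TA] := gP j.
      rewrite -linearB -[_ - _]/(A j u) TA.
      rewrite (@big_cat_nat _ _ _ (g j).1.1)//= [X in _ + X]big1_seq ?addr0; last first.
        move=> b /andP[_]; rewrite mem_index_iota /F => /andP[/leq_gtF->].
        by rewrite scale0r.
      by rewrite big_mkord; apply: eq_bigr => b _; rewrite /F ltn_ord.
    rewrite telescope_sumr//.
    have -> : Q 0%N u = 0.
      by rewrite /Q /sampling; case: (f 0%N).1.1 (fP 0%N).1 => // _; rewrite big_ord0.
    by rewrite linear0 subr0.
  have TQ : T (Q J u) @[J --> \oo] --> T u.
    apply/cvgrPdist_lt => e e0; pose K := c * (16 * C * r).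
    have K0 : 0 < K by rewrite !mulr_gt0.
    near=> J; have p0 : 0 < (2 ^ J)%:R ^+ 2 :> R by rewrite exprn_gt0// ltr0n expn_gt0.
    have er : 0 < 16 * C / (2 ^ J)%:R ^+ 2 * r by rewrite !mulr_gt0 ?invr_gt0.
    rewrite -linearB; apply: le_lt_trans (Tn _ _ er (Qerr J u r r0 ur)) _.
    rewrite [ltLHS](_ : _ = K / (2 ^ J)%:R ^+ 2); last by rewrite /K; ring.
    rewrite ltr_pdivrMr// mulrC -ltr_pdivrMr//; apply: (@lt_le_trans _ _ J%:R).
      by near: J; exact: nbhs_infty_gtr.
    rewrite -natrX ler_nat -expnM.
    by rewrite (leq_trans (ltnW (ltn_expl J (ltnSn 1))))// leq_exp2l// leq_pmulr.
  have sub : series w (2 ^ J).-1 @[J --> \oo] --> limn (series w).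
    apply: (@cvg_comp _ _ _ (fun J => (2 ^ J).-1) (series w) _ \oo) => // P [N _ NP].
    exists N => // J /= NJ; apply: NP => /=; rewrite -ltnS prednK ?expn_gt0//.
    by rewrite (leq_ltn_trans NJ)// ltn_expl.
  have <- : limn (series w) = T u; last exact: cw.
  by apply: (cvg_unique _ sub) => //; rewrite (funext sE).
Unshelve. all: by end_near. Qed.

End decay_nuclear.

(** * Measurability of the determinantal condition *)

Section countable_quantifiers.
Context {d : measure_display} {S : measurableType d} {T : countType}.

Lemma measurable_exists (F : T -> set S) :
  (forall a, measurable (F a)) -> measurable [set s | exists a, F a s].
Proof.
move=> mF.
rewrite (_ : [set s | _] = \bigcup_n (if unpickle n is Some a then F a else set0)).
  by apply: bigcupT_measurable => n; case: unpickle.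
apply/seteqP; split=> s [].
  by move=> a Fas; exists (pickle a) => //; rewrite pickleK.
by move=> n _; case: unpickle => // a Fas; exists a.
Qed.

Lemma measurable_forall (F : T -> set S) :
  (forall a, measurable (F a)) -> measurable [set s | forall a, F a s].
Proof.
move=> mF.
rewrite (_ : [set s | _] = ~` [set s | exists a, (~` F a) s]).
  by apply: measurableC; apply: measurable_exists => a; exact: measurableC.
apply/seteqP; split=> s /=; first by move=> Fs [a]; apply.
by move=> nF a; apply: contrapT => nFa; apply: nF; exists a.
Qed.

End countable_quantifiers.

Section measurability.
Variable R : realType.

Lemma measurable_hits (U : set (CR R)) : open U ->
  measurable [set X : SF R | SF_set X `&` U !=set0].
Proof. by move=> oU; apply: sub_sigma_algebra; exists U. Qed.

Lemma near_eval (x : CR R) (s e : R) : 0 < e ->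
  \forall y \near x, `|CR_fun y s - CR_fun x s| < e.
Proof.
move=> e0; have e2 : 0 < e / 2 by rewrite divr_gt0.
apply: filterS (near_bnd x (Num.trunc `|s|).+1 e2) => y yx.
apply: (@le_lt_trans _ _ (e / 2)); last by rewrite ltr_pdivrMr// ltr_pMr// ltr1n.
by apply: yx; rewrite ltW// truncnS_gt.
Qed.

Lemma open_eval k (s a : 'I_k -> R) (e : R) :
  open [set x : CR R | forall j, `|CR_fun x (s j) - a j| < e].
Proof.
rewrite openE => x /= xa; rewrite /interior/=.
apply: (@filter_forall _ _ (fun j (y : CR R) => `|CR_fun y (s j) - a j| < e) (nbhs x)
  (nbhs_filter x)) => j.
have d0 : 0 < e - `|CR_fun x (s j) - a j| by rewrite subr_gt0.
apply: filterS (near_eval x (s j) d0) => y yx /=.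
rewrite -(subrK (CR_fun x (s j)) (CR_fun y (s j))) -addrA.
by apply: le_lt_trans (ler_normD _ _) _; rewrite -ltrBrDr.
Qed.

Lemma det_lt_stable k (M : 'M[R]_k) (c : R) : c < `|\det M| ->
  exists e : nat, forall N : 'M[R]_k,
    (forall i j, `|N i j - M i j| < e.+1%:R^-1) -> c < `|\det N|.
Proof.
move=> cM; apply: contrapT => nex.
have /choice[N NP] : forall e : nat, exists N : 'M[R]_k,
    (forall i j, `|N i j - M i j| < e.+1%:R^-1) /\ `|\det N| <= c.
  move=> e; apply: contrapT => nN; apply: nex; exists e => N NM.
  by rewrite ltNge; apply/negP => Nc; apply: nN; exists N.
have NM : (fun e => \det (N e)) @ \oo --> \det M.
  apply: det_cvg => i j; apply/cvgrPdist_lt => d d0.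
  have := @near_infty_natSinv_lt R (PosNum d0); apply: filterS => e /= ed.
  by rewrite distrC; apply: lt_trans ed; exact: (NP e).1.
have : `|\det M| <= c.
  apply: (closed_cvg (fun z => z <= c) _ _ _ (cvg_norm NM)); first exact: closed_le.
  by apply: nearW => e; exact: (NP e).2.
by rewrite leNgt cM.
Qed.

(** Large determinants are an open condition on the samples, so they can be
    witnessed by a rational matrix [A] and a tolerance [e.+1%:R^-1] such that all
    matrices within that tolerance of [A] have a large determinant.  For fixed [A]
    and [e] the elements [x i] can be looked for independently of each other, each
    in the open set [U] cut out by a row of [A]; this is a finite intersection of
    generators of the Effros structure. *)
Lemma measurable_det_gt m k (s : 'I_k -> R) (c : R) : measurable
  [set X : SF R | exists x : 'I_k -> CR R,
    (forall i, SF_set X (x i) /\ unit_nbhs m (x i)) /\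
    c < `|\det (\matrix_(i, j) CR_fun (x i) (s j))|].
Proof.
pose U (e : nat) (a : 'rV[rat]_k) : set (CR R) := unit_nbhs m `&`
  [set x | forall j, `|CR_fun x (s j) - ratr (a 0 j)| < e.+1%:R^-1].
have oU e a : open (U e a).
  by apply: openI; [exact: open_interior|exact: open_eval].
pose good (e : nat) (A : 'M[rat]_k) := forall M : 'M[R]_k,
  (forall i j, `|M i j - ratr (A i j)| < e.+1%:R^-1) -> c < `|\det M|.
rewrite (_ : [set X | _] = [set X | exists q : nat * 'M[rat]_k,
    good q.1 q.2 /\ forall i, (SF_set X `&` U q.1 (row i q.2)) !=set0]).
  apply: measurable_exists => -[e A] /=.
  have [gA|nA] := pselect (good e A); last first.
    by rewrite [Z in measurable Z](_ : _ = set0)//; apply/seteqP; split=> X // [].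
  rewrite [Z in measurable Z](_ : _ = [set X : SF R |
      forall i, (SF_set X `&` U e (row i A)) !=set0]).
    by apply: measurable_forall => i; exact: measurable_hits.
  by apply/seteqP; split=> X /=; [case|].
apply/seteqP; split=> X /=; last first.
  move=> [[e A] /= [gA /choice[x xP]]]; exists x; split=> [i|].
    by have [Xx [ux _]] := xP i.
  apply: gA => i j; have [_ [_ /(_ j)]] := xP i.
  by rewrite !mxE.
move=> [x [Xx cx]]; have [e eP] := det_lt_stable cx.
(* [(e.*2.+1).+1%:R^-1] is half of the tolerance [e.+1%:R^-1]: one half is spent
   on the rational approximation, the other on the deviation from it *)
have e0 : 0 < (e.*2.+1).+1%:R^-1 :> R by rewrite invr_gt0.
have /choice[A AP] : forall ij : 'I_k * 'I_k, exists q : rat,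
    `|CR_fun (x ij.1) (s ij.2) - ratr q| < (e.*2.+1).+1%:R^-1.
  move=> [i j] /=.
  move: (_^-1) e0 => d d0.
  have lt_e : CR_fun (x i) (s j) < CR_fun (x i) (s j) + d by rewrite ltrDl.
  have [q] := rat_in_itvoo lt_e; rewrite in_itv/= => /andP[q1 q2]; exists q.
  by rewrite ltr_distlC; apply/andP; split; lra.
exists (e.*2.+1, \matrix_(i, j) A (i, j)); split=> /= [M MA|i].
  apply: eP => i j; rewrite mxE.
  rewrite -(subrK (ratr (A (i, j))) (M i j)) -addrA.
  apply: le_lt_trans (ler_normD _ _) _.
  have -> : e.+1%:R^-1 = (e.*2.+1).+1%:R^-1 + (e.*2.+1).+1%:R^-1 :> R.
    rewrite (_ : (e.*2.+1).+1 = (2 * e.+1)%N); last by rewrite mul2n doubleS.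
    by rewrite natrM invfM mulrC -splitr.
  by apply: ltrD; [have := MA i j; rewrite mxE|rewrite distrC; exact: (AP (i, j))].
exists (x i); split; first exact: (Xx i).1.
split; first exact: (Xx i).2.
by move=> j /=; rewrite !mxE; exact: (AP (i, j)).
Qed.

Lemma measurable_det_decay : measurable [set X : SF R | det_decay X].
Proof.
apply: measurable_forall => n; apply: measurable_exists => m.
apply: measurable_exists => C; apply: measurable_forall => k.
rewrite [Z in measurable Z](_ : _ = [set X : SF R | forall t : {ffun 'I_k -> nat},
  (~` [set X : SF R | exists x : 'I_k -> CR R,
    (forall i, SF_set X (x i) /\ unit_nbhs m (x i)) /\
    (C%:R / k%:R ^+ 2) ^+ k < `|\det (\matrix_(i, j) CR_fun (x i) (pt R n (t j)))|]) X]).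
  by apply: measurable_forall => t; apply: measurableC; exact: measurable_det_gt.
apply/seteqP; split=> X /= H t.
  by move=> [x [Xx]]; rewrite ltNge => /negP; apply; exact: H.
move=> x Xx; rewrite leNgt; apply/negP => lt_det.
apply: (H [ffun j => t j]); exists x; split=> //.
by rewrite (_ : \matrix_(i, j) _ = \matrix_(i, j) CR_fun (x i) (pt R n (t j)))//;
  apply/matrixP => i j; rewrite !mxE ffunE.
Qed.

End measurability.

Theorem theorem4p16 (R : realType) : measurable (Nuc (R := R) : set (SF R)).
Proof.
rewrite (_ : @Nuc R = [set X : SF R | det_decay X]).
  exact: measurable_det_decay.
by apply/seteqP; split=> X; [exact: nuclear_det_decay|exact: det_decay_nuclear].
Qed.
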